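(* Let $S$ be a semiring. Then the following statements are equivalent: (1) Each nonzero finitely generated ideal of $S$ is an invertible ideal of $S$. (2) The semiring $S$ is a semidomain and every nonzero $2$-generated ideal of $S$ is an invertible ideal of $S$.
   Context: A semiring is a set $S$ with operations $+,\cdot$ such that $(S,+)$ is a commutative monoid with identity $0$, $(S,\cdot)$ is a commutative monoid with identity $1\neq 0$, multiplication distributes over addition, and $s\cdot 0=0$ for all $s\in S$. An ideal of $S$ is a nonempty subset $I\subseteq S$ such that $a,b\in I$ and $s\in S$ imply $a+b, sa\in I$. An element $s\in S$ is multiplicatively cancellable (MC) if $sb=sc$ implies $b=c$ for all $b,c\in S$; $S$ is a semidomain if every nonzero element of $S$ is MC. The total quotient semiring $Q(S)$ is the localization of $S$ at the set $M$ of its MC elements: the set of classes $a/b$ of pairs $(a,b)\in S\times M$ under $(a,b)\sim(c,d)$ iff $tad=tbc$ for some $t\in M$, with $a/b+c/d=(ad+bc)/(bd)$ and $(a/b)(c/d)=(ac)/(bd)$; $S$ is viewed inside $Q(S)$ via $s\mapsto s/1$. A fractional ideal of $S$ is a nonempty subset $I\subseteq Q(S)$ closed under addition and under multiplication by elements of $S$, such that $dI\subseteq S$ for some MC element $d\in S$. The product of fractional ideals is $IJ=\{a_1b_1+\cdots+a_nb_n: a_i\in I,\ b_i\in J\}$. A fractional ideal (in particular an ideal) $I$ of $S$ is invertible if $IJ=S$ for some fractional ideal $J$ of $S$. *)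

(* Defs.v *)
From HB Require Import structures.
From mathcomp Require Import all_boot all_algebra.
From mathcomp Require Import mathcomp_extra boolp classical_sets.
From mathcomp Require Import ring.

Set Implicit Arguments.
Unset Strict Implicit.
Unset Printing Implicit Defensive.

Import GRing.Theory.
Local Open Scope classical_set_scope.
Local Open Scope quotient_scope.
Local Open Scope ring_scope.

(* A commutative semiring with 1 != 0 is a [comNzSemiRingType]; an element [s]
   is multiplicatively cancellable when [GRing.lreg s], which unfolds to
   [forall b c, s * b = s * c -> b = c]. *)

Definition semidomain (S : comNzSemiRingType) : Prop :=
  forall s : S, s != 0 -> GRing.lreg s.

Definition is_ideal (S : comNzSemiRingType) (I : set S) : Prop :=
  [/\ I !=set0,
      forall a b : S, I a -> I b -> I (a + b) &
      forall s a : S, I a -> I (s * a)].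

(* [smallest C G] is the intersection of all sets satisfying [C] that
   contain [G]. *)
Definition ideal_gen (S : comNzSemiRingType) (A : set S) : set S :=
  smallest (@is_ideal S) A.

Definition fin_generated (S : comNzSemiRingType) (I : set S) : Prop :=
  exists A : seq S, I = ideal_gen [set` A].

(* The two generators need not be distinct, so principal ideals are
   included. *)
Definition two_generated (S : comNzSemiRingType) (I : set S) : Prop :=
  exists a b : S, I = ideal_gen [set a; b].

(* Pairs [(a, b)] with [b] multiplicatively cancellable.  The condition is
   turned into a boolean so that the subtype is proof irrelevant. *)
Record mcfrac (S : comNzSemiRingType) : Type := MCFrac {
  mcfrac_val :> S * S;
  mcfrac_valP : `[< GRing.lreg mcfrac_val.2 >]
}.
HB.instance Definition _ (S : comNzSemiRingType) :=
  [isSub for @mcfrac_val S].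
HB.instance Definition _ (S : comNzSemiRingType) :=
  [Choice of mcfrac S by <:].

Definition mkfrac (S : comNzSemiRingType) (a b : S) (mcb : GRing.lreg b) :
  mcfrac S := @MCFrac S (a, b) (asboolT mcb).

Lemma mcfrac_den (S : comNzSemiRingType) (x : mcfrac S) : GRing.lreg x.2.
Proof. exact/asboolP/mcfrac_valP. Qed.
Arguments mcfrac_den {S} x.

Definition equivq (S : comNzSemiRingType) (x y : mcfrac S) : bool :=
  `[< exists2 t : S, GRing.lreg t & t * (x.1 * y.2) = t * (x.2 * y.1) >].

Lemma equivqP (S : comNzSemiRingType) (x y : mcfrac S) :
  reflect (exists2 t : S, GRing.lreg t & t * (x.1 * y.2) = t * (x.2 * y.1))
          (equivq x y).
Proof. exact: asboolP. Qed.

Lemma equivqE (S : comNzSemiRingType) (x y : mcfrac S) :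
  equivq x y = (x.1 * y.2 == x.2 * y.1).
Proof.
by apply/equivqP/eqP => [[t mct /mct]|e] //; exists 1; [exact: lreg1|rewrite e].
Qed.

Lemma equivq_refl (S : comNzSemiRingType) : reflexive (@equivq S).
Proof. by move=> x; rewrite equivqE mulrC. Qed.

Lemma equivq_sym (S : comNzSemiRingType) : symmetric (@equivq S).
Proof.
by move=> x y; rewrite !equivqE eq_sym; congr (_ == _); rewrite mulrC.
Qed.

Lemma equivq_trans (S : comNzSemiRingType) : transitive (@equivq S).
Proof.
move=> y x z; rewrite !equivqE => /eqP xy /eqP yz.
apply/eqP; apply: (mcfrac_den y).
by rewrite mulrA (mulrC y.2) xy -mulrA yz mulrCA.
Qed.

Canonical equivq_equiv (S : comNzSemiRingType) :=
  EquivRel (@equivq S) (@equivq_refl S) (@equivq_sym S) (@equivq_trans S).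

(* The total quotient semiring Q(S): the localization of [S] at its
   multiplicatively cancellable elements.  Its operations are characterized by
   [addqE], [mulqE] and [qfrac_eq]. *)
Definition Qsr (S : comNzSemiRingType) : Type := {eq_quot (@equivq S)}.
HB.instance Definition _ (S : comNzSemiRingType) := Choice.on (Qsr S).
HB.instance Definition _ (S : comNzSemiRingType) :
  EqQuotient _ (@equivq S) (Qsr S) := EqQuotient.on (Qsr S).

(* The class a/b. *)
Definition qfrac (S : comNzSemiRingType) (a b : S) (mcb : GRing.lreg b) :
  Qsr S := \pi_(Qsr S) (mkfrac a mcb).

Lemma equivq_repr (S : comNzSemiRingType) (x : mcfrac S) :
  x.1 * (repr (\pi_(Qsr S) x)).2 = x.2 * (repr (\pi_(Qsr S) x)).1.
Proof. by apply/eqP; rewrite -equivqE -eqmodE reprK. Qed.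

Definition addq_pre (S : comNzSemiRingType) (x y : mcfrac S) : mcfrac S :=
  mkfrac (x.1 * y.2 + x.2 * y.1) (lregM (mcfrac_den x) (mcfrac_den y)).

Definition mulq_pre (S : comNzSemiRingType) (x y : mcfrac S) : mcfrac S :=
  mkfrac (x.1 * y.1) (lregM (mcfrac_den x) (mcfrac_den y)).

Definition addq (S : comNzSemiRingType) : Qsr S -> Qsr S -> Qsr S :=
  lift_op2 (Qsr S) (@addq_pre S).

Definition mulq (S : comNzSemiRingType) : Qsr S -> Qsr S -> Qsr S :=
  lift_op2 (Qsr S) (@mulq_pre S).

Definition toQ (S : comNzSemiRingType) (s : S) : Qsr S := qfrac s (@lreg1 S).

Lemma pi_eqP (S : comNzSemiRingType) (x y : mcfrac S) :
  (\pi_(Qsr S) x = \pi_(Qsr S) y) <-> x.1 * y.2 = x.2 * y.1.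
Proof.
by split=> [/eqmodP|e]; [|apply/eqmodP]; rewrite /= equivqE ?e // => /eqP.
Qed.

Lemma pi_addq (S : comNzSemiRingType) (x y : mcfrac S) :
  addq (\pi_(Qsr S) x) (\pi_(Qsr S) y) = \pi_(Qsr S) (addq_pre x y).
Proof.
unlock addq mulq; apply/pi_eqP => /=.
have := equivq_repr y; have := equivq_repr x.
set x' := repr _ => ex; set y' := repr _ => ey.
transitivity ((x.2 * x'.1) * (y.2 * y'.2) + (y.2 * y'.1) * (x.2 * x'.2)).
  ring.
by rewrite -ex -ey; ring.
Qed.

Lemma pi_mulq (S : comNzSemiRingType) (x y : mcfrac S) :
  mulq (\pi_(Qsr S) x) (\pi_(Qsr S) y) = \pi_(Qsr S) (mulq_pre x y).
Proof.
unlock addq mulq; apply/pi_eqP => /=.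
have := equivq_repr y; have := equivq_repr x.
set x' := repr _ => ex; set y' := repr _ => ey.
transitivity ((x.2 * x'.1) * (y.2 * y'.1)); first by ring.
by rewrite -ex -ey; ring.
Qed.

Lemma addqA (S : comNzSemiRingType) : associative (@addq S).
Proof.
elim/quotW=> x; elim/quotW=> y; elim/quotW=> z.
by rewrite !pi_addq; apply/pi_eqP => /=; ring.
Qed.

Lemma addqC (S : comNzSemiRingType) : commutative (@addq S).
Proof.
elim/quotW=> x; elim/quotW=> y.
by rewrite !pi_addq; apply/pi_eqP => /=; ring.
Qed.

Lemma add0q (S : comNzSemiRingType) : left_id (toQ 0) (@addq S).
Proof. by elim/quotW=> x; rewrite pi_addq; apply/pi_eqP => /=; ring. Qed.

HB.instance Definition _ (S : comNzSemiRingType) :=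
  GRing.isNmodule.Build (Qsr S) (@addqA S) (@addqC S) (@add0q S).

Lemma mulqA (S : comNzSemiRingType) : associative (@mulq S).
Proof.
elim/quotW=> x; elim/quotW=> y; elim/quotW=> z.
by rewrite !pi_mulq; apply/pi_eqP => /=; ring.
Qed.

Lemma mulqC (S : comNzSemiRingType) : commutative (@mulq S).
Proof.
elim/quotW=> x; elim/quotW=> y.
by rewrite !pi_mulq; apply/pi_eqP => /=; ring.
Qed.

Lemma mul1q (S : comNzSemiRingType) : left_id (toQ 1) (@mulq S).
Proof. by elim/quotW=> x; rewrite pi_mulq; apply/pi_eqP => /=; ring. Qed.

Lemma mulqDl (S : comNzSemiRingType) :
  left_distributive (@mulq S) (@addq S).
Proof.
elim/quotW=> x; elim/quotW=> y; elim/quotW=> z.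
by rewrite !(pi_addq, pi_mulq); apply/pi_eqP => /=; ring.
Qed.

Lemma mul0q (S : comNzSemiRingType) : left_zero (toQ 0) (@mulq S).
Proof. by elim/quotW=> x; rewrite pi_mulq; apply/pi_eqP => /=; ring. Qed.

Lemma oneq_neq0 (S : comNzSemiRingType) : toQ 1 != toQ 0 :> Qsr S.
Proof.
by apply/eqP => /pi_eqP /=; rewrite !mul1r => /eqP; rewrite oner_eq0.
Qed.

HB.instance Definition _ (S : comNzSemiRingType) :=
  GRing.Nmodule_isComNzSemiRing.Build (Qsr S)
    (@mulqA S) (@mulqC S) (@mul1q S) (@mulqDl S) (@mul0q S) (@oneq_neq0 S).

Lemma addqE (S : comNzSemiRingType) (a b c d : S)
    (mcb : GRing.lreg b) (mcd : GRing.lreg d) :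
  qfrac a mcb + qfrac c mcd = qfrac (a * d + b * c) (lregM mcb mcd).
Proof. by rewrite [LHS]pi_addq; apply/pi_eqP => /=; ring. Qed.

Lemma mulqE (S : comNzSemiRingType) (a b c d : S)
    (mcb : GRing.lreg b) (mcd : GRing.lreg d) :
  qfrac a mcb * qfrac c mcd = qfrac (a * c) (lregM mcb mcd).
Proof. by rewrite [LHS]pi_mulq; apply/pi_eqP => /=; ring. Qed.

Lemma qfrac_eq (S : comNzSemiRingType) (a b c d : S)
    (mcb : GRing.lreg b) (mcd : GRing.lreg d) :
  qfrac a mcb = qfrac c mcd <->
  exists2 t : S, GRing.lreg t & t * (a * d) = t * (b * c).
Proof.
split=> [/eqmodP /equivqP //|e]; exact/eqmodP/equivqP.
Qed.

Lemma toQ_inj (S : comNzSemiRingType) : injective (@toQ S).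
Proof. by move=> a b /pi_eqP /=; rewrite mul1r mulr1. Qed.

Lemma toQ_is_nmod_morphism (S : comNzSemiRingType) :
  nmod_morphism (@toQ S).
Proof.
split=> // a b; apply/esym; rewrite [LHS]addqE.
by apply/pi_eqP => /=; ring.
Qed.

Lemma toQ_is_monoid_morphism (S : comNzSemiRingType) :
  monoid_morphism (@toQ S).
Proof.
split=> // a b; apply/esym; rewrite [LHS]mulqE.
by apply/pi_eqP => /=; ring.
Qed.

HB.instance Definition _ (S : comNzSemiRingType) :=
  GRing.isNmodMorphism.Build S (Qsr S) (@toQ S) (@toQ_is_nmod_morphism S).
HB.instance Definition _ (S : comNzSemiRingType) :=
  GRing.isMonoidMorphism.Build S (Qsr S) (@toQ S) (@toQ_is_monoid_morphism S).

Definition fractional_ideal (S : comNzSemiRingType) (I : set (Qsr S)) : Prop :=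
  [/\ I !=set0,
      forall x y : Qsr S, I x -> I y -> I (x + y),
      forall (s : S) (x : Qsr S), I x -> I (toQ s * x) &
      exists2 d : S, GRing.lreg d &
        forall x : Qsr S, I x -> range (@toQ S) (toQ d * x)].

Definition fideal_mul (S : comNzSemiRingType) (I J : set (Qsr S)) :
    set (Qsr S) :=
  [set x | exists (n : nat) (a b : 'I_n.+1 -> Qsr S),
     [/\ forall i, I (a i), forall i, J (b i) & x = \sum_i a i * b i]].

(* For a fractional ideal [I]; the unit for the product is the image of [S]. *)
Definition finvertible (S : comNzSemiRingType) (I : set (Qsr S)) : Prop :=
  exists2 J : set (Qsr S),
    fractional_ideal J & fideal_mul I J = range (@toQ S).

Lemma ideal_fractional (S : comNzSemiRingType) (I : set S) :
  is_ideal I -> fractional_ideal (@toQ S @` I).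
Proof.
move=> [[a Ia] ID IM]; split.
- by exists (toQ a); exists a.
- by move=> _ _ [x Ix <-] [y Iy <-]; exists (x + y); [exact: ID|exact: raddfD].
- by move=> s _ [x Ix <-]; exists (s * x); [exact: IM|exact: rmorphM].
exists 1; first exact: lreg1.
by move=> _ [x Ix <-]; exists x => //; rewrite rmorph1 mul1r.
Qed.

(* An ideal of [S] is a fractional ideal once [S] is identified with its image
   in [Qsr S]; see [ideal_fractional]. *)
Definition invertible_ideal (S : comNzSemiRingType) (I : set S) : Prop :=
  finvertible (@toQ S @` I).

(* Main.v *)
Require Import Defs.
From mathcomp Require Import all_boot all_algebra.
From mathcomp Require Import boolp classical_sets.

Import GRing.Theory.
Local Open Scope classical_set_scope.
Local Open Scope ring_scope.

(** If [(s)] is invertible then [1] is a sum of multiples of [s] in the total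
    quotient semiring, so [s] can be cancelled; this gives the semidomain half
    of one direction, and the rest of that direction is immediate.

    Conversely, write [I^-1] for the set of [x] with [I x] contained in [S].
    Over a semidomain a nonzero ideal [I] is invertible exactly when [1] lies
    in [I I^-1] ([invertible_idealP]).  Let [I] be generated by [a], [m], [c],
    where [m] is a finite list and [a], [c] are single elements, and let [B],
    [C], [D] be the ideals generated by [a], [m], by [m], [c] and by [a], [c].
    If [1] lies in [B B^-1] and [w] is in [D^-1], multiply by [a w]: this is an
    element of [S], and [(a w) B^-1] is contained in [I^-1], because it sends
    [B] into [S] and sends [c] to [(c w) (a B^-1)].  Hence [a w] lies in
    [I I^-1], and symmetrically [c w] does, through [C].  So
    [D D^-1] is contained in [I I^-1], and [I] is invertible if [B], [C] and
    [D] are ([dual_unit_amalgam]).  No subtraction occurs, and induction on the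
    number of generators reduces everything to at most two generators. *)

Section TotalQuotient.
Set Implicit Arguments.
Unset Strict Implicit.
Unset Printing Implicit Defensive.
Variable S : comNzSemiRingType.
Implicit Types (a b c d s t : S) (x y z w : Qsr S).
Implicit Types (A G I : set S) (J K : set (Qsr S)).

(** * Generated ideals *)

Lemma ideal_gen_is_ideal G : is_ideal (ideal_gen G).
Proof.
split.
- by exists 0 => I [[[a Ia] _ IM] _]; rewrite -(mul0r a); exact: IM.
- by move=> a b Ga Gb I GI; case: (GI) => -[_ ID _] _; apply: ID;
    [exact: Ga GI|exact: Gb GI].
- by move=> s a Ga I GI; case: (GI) => -[_ _ IM] _; apply/IM/(Ga I GI).
Qed.

Lemma ideal_gen_mem G a : G a -> ideal_gen G a.
Proof. by move=> Ga I [_]; exact. Qed.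

Lemma ideal_gen_min G I : is_ideal I -> G `<=` I -> ideal_gen G `<=` I.
Proof. by move=> idI GI a; apply. Qed.

Lemma ideal_gen_mono G A : G `<=` A -> ideal_gen G `<=` ideal_gen A.
Proof.
move=> GA; apply: ideal_gen_min; first exact: ideal_gen_is_ideal.
by move=> a /GA; exact: ideal_gen_mem.
Qed.

Lemma is_ideal0 I : is_ideal I -> I 0.
Proof. by move=> [[a Ia] _ IM]; rewrite -(mul0r a); exact: IM. Qed.

Lemma ideal_neq0P I : is_ideal I -> I <> [set 0] <-> exists2 d, I d & d != 0.
Proof.
move=> idI; split=> [I0|[d Id d0] I0].
  apply: contrapT => noI; apply: I0; apply/seteqP; split=> [d Id|_ ->].
    by apply/eqP; apply: contrapT => /negP d0; apply: noI; exists d.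
  exact: is_ideal0.
by move: Id; rewrite I0 => /eqP; rewrite (negbTE d0).
Qed.

Lemma ideal_gen_neq0 G a : G a -> a != 0 -> ideal_gen G <> [set 0].
Proof.
move=> Ga a0; apply/ideal_neq0P; first exact: ideal_gen_is_ideal.
by exists a => //; exact: ideal_gen_mem.
Qed.

(** Discarding zero generators ensures that every ideal generated by a nonempty
    part of the remaining ones is again nonzero, so that the induction on the
    number of generators can use its hypothesis. *)
Lemma ideal_gen_filter_neq0 (r : seq S) :
  ideal_gen [set` r] = ideal_gen [set` [seq a <- r | a != 0]].
Proof.
apply/seteqP; split.
  apply: ideal_gen_min => [|a /= ra]; first exact: ideal_gen_is_ideal.
  have [->|a0] := eqVneq a 0.
    by apply: is_ideal0; exact: ideal_gen_is_ideal.
  by apply: ideal_gen_mem; rewrite /= mem_filter a0.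
by apply: ideal_gen_mono => a /=; rewrite mem_filter => /andP[].
Qed.

(** * Products of subsets of the total quotient semiring *)

Lemma fideal_mul_prod J K x y : J x -> K y -> fideal_mul J K (x * y).
Proof.
move=> Jx Ky; exists 0, (fun=> x), (fun=> y).
by split=> //; rewrite big_ord_recl big_ord0 addr0.
Qed.

(** Two sums are concatenated by indexing over ['I_(n.+1 + p.+1)], which
    computes to the nonempty index type ['I_(n + p.+1).+1]. *)
Lemma fideal_mulD J K x y :
  fideal_mul J K x -> fideal_mul J K y -> fideal_mul J K (x + y).
Proof.
move=> [n [a [b [Ja Kb ->]]]] [p [c [d [Jc Kd ->]]]].
pose glue (f : 'I_n.+1 -> Qsr S) (g : 'I_p.+1 -> Qsr S)
  (i : 'I_(n.+1 + p.+1)) :=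
    match fintype.split i with inl j => f j | inr j => g j end.
exists (n + p.+1)%N, (glue a c), (glue b d); split.
- by move=> i; rewrite /glue; case: fintype.split.
- by move=> i; rewrite /glue; case: fintype.split.
have gluel f g i : glue f g (lshift _ i) = f i.
  by rewrite /glue -[lshift _ i]/(unsplit (inl i)) unsplitK.
have gluer f g i : glue f g (rshift _ i) = g i.
  by rewrite /glue -[rshift _ i]/(unsplit (inr i)) unsplitK.
rewrite [RHS](@big_split_ord _ _ _ n.+1 p.+1) /=.
by congr (_ + _); apply: eq_bigr => i _; rewrite ?gluel ?gluer.
Qed.

Lemma fideal_mul_ind J K (P : set (Qsr S)) :
  P 0 -> (forall x y, P x -> P y -> P (x + y)) ->
  (forall x y, J x -> K y -> P (x * y)) -> fideal_mul J K `<=` P.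
Proof.
move=> P0 PD PM _ [n [a [b [Ja Kb ->]]]].
by apply: (big_ind P) => // i _; exact: PM.
Qed.

Lemma fideal_mul_scale J J' K K' z x :
  J `<=` J' -> (forall y, K y -> K' (z * y)) ->
  fideal_mul J K x -> fideal_mul J' K' (z * x).
Proof.
move=> JJ' KK' [n [a [b [Ja Kb ->]]]].
exists n, a, (fun i => z * b i); split=> [i|i|].
- exact: JJ'.
- exact: KK'.
- by rewrite mulr_sumr; apply: eq_bigr => i _; rewrite mulrCA.
Qed.

Lemma range_toQD x y :
  range (@toQ S) x -> range (@toQ S) y -> range (@toQ S) (x + y).
Proof. by move=> [a _ <-] [b _ <-]; exists (a + b); rewrite ?rmorphD. Qed.

Lemma range_toQM x y :
  range (@toQ S) x -> range (@toQ S) y -> range (@toQ S) (x * y).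
Proof. by move=> [a _ <-] [b _ <-]; exists (a * b); rewrite ?rmorphM. Qed.

Lemma range_toQ0 : range (@toQ S) 0.
Proof. by exists 0; rewrite ?rmorph0. Qed.

(** * The dual of an ideal and invertibility *)

Definition dual A : set (Qsr S) :=
  [set x | forall a, A a -> range (@toQ S) (toQ a * x)].

Lemma dual0 A : dual A 0.
Proof. by move=> a _; rewrite mulr0; exact: range_toQ0. Qed.

Lemma dualD A x y : dual A x -> dual A y -> dual A (x + y).
Proof.
by move=> Ax Ay a Aa; rewrite mulrDr; apply: range_toQD; [exact: Ax|exact: Ay].
Qed.

Lemma dual_scale A z x : range (@toQ S) z -> dual A x -> dual A (z * x).
Proof.
by move=> Sz Ax a Aa; rewrite mulrCA; apply: range_toQM => //; exact: Ax.
Qed.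

Lemma dual_ideal_gen G x :
  (forall a, G a -> range (@toQ S) (toQ a * x)) -> dual (ideal_gen G) x.
Proof.
move=> Gx; apply: (@ideal_gen_min G [set a | range (@toQ S) (toQ a * x)]) => //.
split=> [|a b /= Sa Sb|s a /= Sa].
- by exists 0; rewrite /= rmorph0 mul0r; exact: range_toQ0.
- by rewrite rmorphD mulrDl; exact: range_toQD.
- by rewrite rmorphM -mulrA; apply: range_toQM => //; exists s.
Qed.

Definition dual_product A : set (Qsr S) := fideal_mul (@toQ S @` A) (dual A).

Lemma dual_product0 A : A !=set0 -> dual_product A 0.
Proof.
move=> [a Aa]; rewrite -(mulr0 (toQ a)).
by apply: fideal_mul_prod; [exists a|exact: dual0].
Qed.

(** Any inverse of [I] is contained in the dual, so the dual is the only
    candidate; the semidomain hypothesis makes a nonzero element of [I] a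
    common denominator for it. *)
Lemma invertible_idealP I : semidomain S -> is_ideal I -> I <> [set 0] ->
  invertible_ideal I <-> dual_product I 1.
Proof.
move=> dS idI /(ideal_neq0P idI) [d Id d0]; split=> [[J _ IJ]|I1].
  have : fideal_mul (@toQ S @` I) J 1 by rewrite IJ; exists 1; rewrite ?rmorph1.
  rewrite -{2}[1]mul1r; apply: fideal_mul_scale => // x Jx a Ia.
  by rewrite mul1r -IJ; apply: fideal_mul_prod => //; exists a.
exists (dual I).
  split; first by exists 0; exact: dual0.
  - exact: dualD.
  - by move=> s x; apply: dual_scale; exists s.
  - by exists d; [exact: dS|move=> x Ix; exact: Ix].
apply/seteqP; split.
  apply: fideal_mul_ind; [exact: range_toQ0|exact: range_toQD|].
  by move=> _ x [a Ia <-] Ix; exact: Ix.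
move=> _ [s _ <-]; rewrite -[toQ s]mulr1.
by apply: fideal_mul_scale I1 => // x; apply: dual_scale; exists s.
Qed.

(** Since [1] is a combination of elements of [I] in the total quotient
    semiring, [I] separates the elements of [S]. *)
Lemma invertible_ideal_cancel I b c :
  invertible_ideal I -> (forall d, I d -> d * b = d * c) -> b = c.
Proof.
move=> [J _ IJ] Ibc; apply: toQ_inj.
have : fideal_mul (@toQ S @` I) J 1 by rewrite IJ; exists 1; rewrite ?rmorph1.
suff /[apply] : fideal_mul (@toQ S @` I) J `<=` [set x | x * toQ b = x * toQ c].
  by rewrite /= !mul1r.
apply: fideal_mul_ind => [|x y /= xbc ybc|_ x [d Id <-] Jx] /=.
- by rewrite !mul0r.
- by rewrite !mulrDl xbc ybc.
- by rewrite mulrAC [RHS]mulrAC -!rmorphM Ibc.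
Qed.

Lemma invertible_principal_lreg s :
  invertible_ideal (ideal_gen [set s]) -> GRing.lreg s.
Proof.
move=> inv_s b c sbc; apply: invertible_ideal_cancel inv_s _.
apply: (@ideal_gen_min [set s] [set d | d * b = d * c]) => [|_ ->//].
split=> [|d e /= dbc ebc|t d /= dbc]; first by exists 0; rewrite /= !mul0r.
  by rewrite !mulrDl dbc ebc.
by rewrite -!mulrA dbc.
Qed.

(** * Gluing duals *)

(** Multiplying an expression of [1] as a sum of products of elements of [(G)]
    and of its dual by [a w] turns the second factors into elements of the
    smaller dual of [(A)]: on the new generator [c] this holds because
    [c (a w) x = (c w) (a x)]. *)
Lemma dual_product_extend (G A : set S) a c w : G a -> A `<=` c |` G ->
  G `<=` A -> range (@toQ S) (toQ a * w) -> range (@toQ S) (toQ c * w) ->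
  dual_product (ideal_gen G) 1 -> dual_product (ideal_gen A) (toQ a * w).
Proof.
move=> Ga AcG GA Saw Scw; rewrite -[toQ a * w]mulr1; apply: fideal_mul_scale.
  by apply: image_subset; exact: ideal_gen_mono.
move=> x Gx; apply: dual_ideal_gen => d /AcG [->|Gd].
  rewrite [toQ a * w]mulrC -mulrA mulrA; apply: range_toQM => //.
  by apply: Gx; exact: ideal_gen_mem.
rewrite mulrCA; apply: range_toQM => //.
by apply: Gx; exact: ideal_gen_mem.
Qed.

(** The ideal generated by [a] and [c] decides how the expressions of [1] for
    the two smaller ideals are combined: if [1 = a u + c v] with [u], [v] in
    the dual of [(a, c)], then [a u] times the first expression plus [c v] times
    the second is an expression of [1] for the large ideal. *)
Lemma dual_unit_amalgam (G A : set S) a c :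
  dual_product (ideal_gen (a |` G)) 1 -> dual_product (ideal_gen (c |` G)) 1 ->
  dual_product (ideal_gen [set a; c]) 1 -> A = a |` (c |` G) ->
  dual_product (ideal_gen A) 1.
Proof.
move=> B1 C1 D1 defA.
have A0 : dual_product (ideal_gen A) 0.
  by apply: dual_product0; case: (ideal_gen_is_ideal A).
suff DA : dual_product (ideal_gen [set a; c]) `<=` dual_product (ideal_gen A).
  exact: DA.
apply: fideal_mul_ind => // [x y|_ w [d Dd <-] Dw]; first exact: fideal_mulD.
(* The elements e that send the dual of (a, c) into the target form an ideal, so
   it suffices to treat the two generators a and c. *)
pose P := [set e | forall w, dual [set a; c] w ->
                   dual_product (ideal_gen A) (toQ e * w)].
suff /(_ d Dd w) : ideal_gen [set a; c] `<=` P.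
  by apply=> e De; apply: Dw; exact: ideal_gen_mem.
apply: ideal_gen_min => [|_ [] -> {Dw}w Dw].
- split=> [|e f Pe Pf v Dv|s e Pe v Dv].
  + by exists 0 => v _; rewrite rmorph0 mul0r.
  + by rewrite rmorphD mulrDl; apply: fideal_mulD; [exact: Pe|exact: Pf].
  + rewrite rmorphM mulrAC mulrC; apply: Pe.
    by apply: dual_scale => //; exists s.
- apply: dual_product_extend B1.
  + by left.
  + by rewrite defA setUCA; exact: subset_refl.
  + by rewrite defA setUCA; exact: subsetUr.
  + by apply: Dw; left.
  + by apply: Dw; right.
- apply: dual_product_extend C1.
  + by left.
  + by rewrite defA; exact: subset_refl.
  + by rewrite defA; exact: subsetUr.
  + by apply: Dw; right.
  + by apply: Dw; left.
Qed.

Lemma set_cons a (r : seq S) : [set` a :: r] = a |` [set` r].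
Proof.
apply/seteqP; split=> b /=; rewrite inE.
  by case/predU1P; [left|right].
by case=> [->|/= ->]; rewrite ?eqxx ?orbT.
Qed.

(** The first and the last generator play the roles of [a] and [c], so that both
    smaller ideals have one generator less. *)
Lemma dual_unit_seq (r : seq S) :
  (forall a b, a != 0 -> dual_product (ideal_gen [set a; b]) 1) ->
  r != [::] -> all (fun a => a != 0) r -> dual_product (ideal_gen [set` r]) 1.
Proof.
move=> inv2; have [n] := ubnP (size r); elim: n => // n IHn in r *.
case: r => // a r; case/lastP: r => [_ _ /= /andP[a0 _]|m c].
  by rewrite set_cons1 -[[set a]]setUid; exact: inv2.
rewrite /= size_rcons all_rcons => /ltnSE ltmn _ /and3P[a0 c0 m0].
apply: (@dual_unit_amalgam [set` m] _ a c).
- by rewrite -set_cons; apply: IHn; rewrite //= a0.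
- by rewrite -set_cons; apply: IHn; rewrite //= c0.
- exact: inv2.
- rewrite set_cons; congr (_ `|` _); rewrite -set_cons.
  by apply/seteqP; split=> b /=; rewrite mem_rcons.
Qed.

End TotalQuotient.

Theorem theorem3p1 (S : comNzSemiRingType) :
  (forall I : set S,
     is_ideal I -> fin_generated I -> I <> [set 0] -> invertible_ideal I)
  <->
  (semidomain S /\
   forall I : set S,
     is_ideal I -> two_generated I -> I <> [set 0] -> invertible_ideal I).
Proof.
split=> [inv|[dS inv2] I idI [r defI] I0].
  split=> [s s0|I idI [a [b defI]]].
    apply: invertible_principal_lreg; apply: inv.
    - exact: ideal_gen_is_ideal.
    - exists [:: s]; by rewrite set_cons1.
    - exact: ideal_gen_neq0 s0.
  apply: inv => //; exists [:: a; b]; rewrite defI.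
  by rewrite set_cons set_cons1.
apply/(invertible_idealP dS idI I0).
move: I0; rewrite defI ideal_gen_filter_neq0 => I0.
apply: dual_unit_seq; last exact: filter_all.
- move=> a b a0.
  have idab := @ideal_gen_is_ideal S [set a; b].
  have ab0 : ideal_gen [set a; b] <> [set 0] by apply: ideal_gen_neq0 a0; left.
  apply/(invertible_idealP dS idab ab0); apply: inv2 => //.
  by exists a, b.
- apply/eqP => r0; move: I0; rewrite r0; apply.
  apply/seteqP; split=> [|_ ->]; last first.
    by apply: is_ideal0; exact: ideal_gen_is_ideal.
  apply: ideal_gen_min => //; split=> [|_ _ -> ->|s _ ->] /=; first by exists 0.
    by rewrite addr0.
  by rewrite mulr0.
Qed.
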